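(* Suppose that for every non-constant polynomial $P \in \mathbb{Z}[x]$, $$\limsup_{x,y \geq 2} \frac{\Psi_P(x,y)\,\log y}{y} = \infty,$$ i.e. the quantity $\Psi_P(x,y)\log y / y$ is unbounded as $(x,y)$ ranges over real numbers $x,y \ge 2$. Then for every algebraic number $\alpha$ the set $\mathbb{N}+\alpha = \{n+\alpha : n \in \mathbb{N}\}$ is multiplicatively dependent. In particular, there is no algebraic number $\alpha$ for which $\mathbb{N}+\alpha$ is multiplicatively independent.
   Context: Here $\mathbb{N} = \{n \in \mathbb{Z} : n \ge 0\}$. For a polynomial $P \in \mathbb{Z}[x]$ and real $x,y\ge 2$, $\Psi_P(x,y)$ denotes the number of integers in the set $\{P(n) : 1 \le n < x\}$ all of whose prime factors are less than or equal to $y$. A set $M \subset \mathbb{C}$ is multiplicatively dependent if there exist distinct $x_1,\ldots,x_n \in M$ and integers $k_1,\ldots,k_n$, not all zero, with $\prod_{j=1}^n x_j^{k_j} = 1$; otherwise $M$ is multiplicatively independent. *)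

(* Defs.v *)
From HB Require Import structures.
From mathcomp Require Import all_boot all_order all_algebra finmap complex.
From mathcomp Require Import all_classical all_reals all_analysis.

Set Implicit Arguments.
Unset Strict Implicit.
Unset Printing Implicit Defensive.

Import Order.TTheory GRing.Theory Num.Theory.
Local Open Scope classical_set_scope.
Local Open Scope ring_scope.
Local Open Scope complex_scope.

(* 0 is divisible by every prime, so it is never y-smooth; the sign of m is
   irrelevant. *)
Definition smooth {R : realType} (y : R) (m : int) : Prop :=
  forall p : nat, prime p -> (p%:Z %| m)%Z -> p%:R <= y.

Definition poly_values {R : realType} (P : {poly int}) (x : R) : set int :=
  [set P.[n%:Z] | n in [set n : nat | (1 <= n)%N /\ n%:R < x]].

Definition smooth_values {R : realType} (P : {poly int}) (x y : R) : set int :=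
  poly_values P x `&` [set m | smooth y m].

(* fset_set is only meaningful on finite sets. *)
Lemma finite_smooth_values (R : realType) (P : {poly int}) (x y : R) :
  finite_set (smooth_values P x y).
Proof.
apply: finite_setIl; apply: finite_image.
apply: (sub_finite_set _ (finite_II (Num.truncn x).+1)) => n [_ nx] /=.
by rewrite -(ltr_nat R); apply: lt_trans nx (truncnS_gt x).
Qed.

Definition Psi {R : realType} (P : {poly int}) (x y : R) : nat :=
  #|` fset_set (smooth_values P x y)|%fset.

Definition multiplicatively_dependent {R : realType} (M : set R[i]) : Prop :=
  exists (n : nat) (x : 'I_n -> R[i]) (k : 'I_n -> int),
    [/\ injective x,
        forall j, M (x j),
        exists j, k j <> 0 &
        \prod_(j < n) x j ^ k j = 1].

Definition multiplicatively_independent {R : realType} (M : set R[i]) : Prop :=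
  ~ multiplicatively_dependent M.

Definition algebraic_number {R : realType} (alpha : R[i]) : Prop :=
  algebraicOver (@ratr R[i]) alpha.

Definition nat_translate {R : realType} (alpha : R[i]) : set R[i] :=
  [set n%:R + alpha | n in [set: nat]].

(* Main.v *)
Require Import Defs.
From HB Require Import structures.
From mathcomp Require Import all_boot all_order all_algebra finmap complex.
From mathcomp Require Import all_classical all_reals all_analysis.
From mathcomp Require Import ring lra zify.
Import Order.TTheory GRing.Theory Num.Theory.
Set Implicit Arguments.
Unset Strict Implicit.
Unset Printing Implicit Defensive.
Local Open Scope classical_set_scope.
Local Open Scope ring_scope.
Local Open Scope complex_scope.

(** Let [g] in Z[X] of degree d have the root [alpha].  By Chebyshev's bound on
    the number of primes, the hypothesis for [g (- X)] yields more than
    d (#S + 1) integers n such that g(-n) is nonzero and has only prime factors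
    in S, the set of the primes that are at most y or divide the leading
    coefficient of [g].  For these n and every root r of [g] the number n + r is
    an S-unit, so it suffices to see that S-units of Q(alpha) of that number are
    multiplicatively dependent.

    For every prime p, Chevalley's theorem gives a valuation ring A_p of C in
    which p is not invertible, and the values of algebraic numbers are torsion
    modulo the value of p.  A common power E of the S-units thus has an integer
    valuation for each of the d #S pairs of a root and a prime of S, besides the
    d logarithms of the moduli of the conjugates, and Dirichlet's box principle
    provides a product of powers of S-units, with nontrivial exponents, all of
    whose valuations vanish and all of whose conjugates have modulus close
    to 1.  The conjugates of this product are the eigenvalues of a rational
    matrix.  Its characteristic polynomial has integral coefficients, because a
    rational number in all the A_p is an integer, and they are bounded; the same
    holds for the first powers of the product, which is therefore a root of
    unity, as in Kronecker's theorem.  This replaces both the ideal theory of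
    Q(alpha) and Dirichlet's unit theorem. *)

(** * Chebyshev's upper bound *)

Definition primes_leq (n : nat) : seq nat := [seq p <- iota 0 n.+1 | prime p].

Lemma mem_primes_leq n p : (p \in primes_leq n) = prime p && (p <= n)%N.
Proof. by rewrite mem_filter mem_iota. Qed.

Lemma primes_leq_uniq n : uniq (primes_leq n).
Proof. by rewrite filter_uniq // iota_uniq. Qed.

Lemma prod_primes_dvd (s : seq nat) (m : nat) : uniq s -> all prime s ->
  (forall p, p \in s -> p %| m)%N -> (\prod_(p <- s) p %| m)%N.
Proof.
rewrite uniq_pairwise => us prs dvs.
apply/unstable.Gauss_dvd_prod => [|p /dvs//].
rewrite filter_predT map_id; apply: sub_in_pairwise prs us => p q /= pp pq pNq.
by rewrite prime_coprime // dvdn_prime2.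
Qed.

Lemma bin_leq_exp2 n k : ('C(n, k) <= 2 ^ n)%N.
Proof.
have [kn|nk] := leqP k n; last by rewrite bin_small.
rewrite -[2%N]/(1 + 1)%N expnDn (bigD1 (inord k)) //= inordK //.
by rewrite !exp1n !muln1 leq_addr.
Qed.

Lemma prime_dvd_fact p m : prime p -> (p %| m`!)%N = (p <= m)%N.
Proof.
move=> pp; apply/idP/idP; last by move=> ?; rewrite dvdn_fact ?prime_gt0.
elim: m => [|m IH]; first by rewrite fact0 Euclid_dvd1.
by rewrite factS Euclid_dvdM // => /orP[/dvdn_leq->|/IH/leqW].
Qed.

Lemma prime_dvd_bin_large p n k : prime p -> (k < p)%N -> (n - k < p <= n)%N ->
  (p %| 'C(n, k))%N.
Proof.
move=> pp kp /andP[nkp pn]; have kn : (k <= n)%N by lia.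
have : (p %| n`!)%N by rewrite prime_dvd_fact.
by rewrite -(bin_fact kn) !Euclid_dvdM // !prime_dvd_fact //; lia.
Qed.

Lemma primorial_leq n : (\prod_(p <- primes_leq n) p <= 8 ^ n)%N.
Proof.
elim/ltn_ind: n => n IH; have [n1|n1] := leqP n 1.
  by move: n n1 {IH}; do 2?case=> //; rewrite unlock.
pose k := n./2; pose large := [seq p <- iota (n - k).+1 k | prime p].
have -> : primes_leq n = primes_leq (n - k) ++ large.
  have nE : n.+1 = ((n - k).+1 + k)%N by rewrite /k; lia.
  by rewrite /primes_leq nE iotaD filter_cat.
have large_leq : (\prod_(p <- large) p <= 2 ^ n)%N.
  apply: leq_trans (bin_leq_exp2 n k); apply: dvdn_leq.
    by rewrite bin_gt0 /k; lia.
  apply: prod_primes_dvd; rewrite ?filter_uniq ?iota_uniq ?filter_all // => p.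
  rewrite mem_filter mem_iota => /andP[pp np].
  by apply: prime_dvd_bin_large => //; rewrite /k in np *; lia.
rewrite big_cat /=; apply: leq_trans (leq_mul (IH _ _) large_leq) _.
  by rewrite /k; lia.
rewrite -[8%N]/(2 ^ 3)%N -!expnM -expnD leq_pexp2l // /k; lia.
Qed.

Lemma ln_prod (R : realType) (I : Type) (r : seq I) (P : pred I) (f : I -> R) :
  (forall i, P i -> 0 < f i) ->
  ln (\prod_(i <- r | P i) f i) = \sum_(i <- r | P i) ln (f i).
Proof.
move=> f_gt0; suff [] : 0 < \prod_(i <- r | P i) f i /\
  ln (\prod_(i <- r | P i) f i) = \sum_(i <- r | P i) ln (f i) by [].
elim/big_ind2: _ => [|x y x' y' [x0 <-] [x'0 <-]|i Pi].
- by rewrite ln1.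
- by rewrite mulr_gt0 // lnM.
- by rewrite f_gt0.
Qed.

Lemma sum_ln_primes_leq (R : realType) n :
  \sum_(p <- primes_leq n) ln (p%:R : R) <= n%:R * ln 8.
Proof.
have prime_pos p : p \in primes_leq n -> 0 < (p%:R : R).
  by rewrite mem_primes_leq => /andP[/prime_gt0 p0 _]; rewrite ltr0n.
rewrite big_seq -ln_prod // -big_seq mulr_natl -lnXn //.
rewrite ler_ln ?posrE ?exprn_gt0 //; last first.
  by rewrite big_seq; apply: prodr_gt0.
by rewrite -natr_prod -natrX ler_nat primorial_leq.
Qed.

Lemma count_primes_leq_le (R : realType) (n : nat) (r : R) : 0 <= r ->
  (count (fun p => p%:R <= r) (primes_leq n))%:R <= r.
Proof.
move=> r0; apply: (@le_trans _ _ (Num.truncn r)%:R); last by rewrite truncn_le.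
rewrite ler_nat -size_filter -[leqRHS](size_iota 1); apply: uniq_leq_size.
  by rewrite filter_uniq // primes_leq_uniq.
move=> p; rewrite mem_filter mem_primes_leq => /and3P[pr /prime_gt0 p0 _].
by rewrite mem_iota p0 add1n ltnS truncn_ge_nat.
Qed.

(* A prime p satisfies ln y <= 2 ln p, unless it is one of the at most
   sqrt y primes below sqrt y. *)
Lemma chebyshev_upper (R : realType) (y : R) : 2 <= y ->
  (size (primes_leq (Num.truncn y)))%:R * ln y <= (2 + 2 * ln 8) * y.
Proof.
move=> y2; set n := Num.truncn y; pose r := Num.sqrt y.
have y0 : 0 < y by lra.
have r0 : 0 < r by rewrite sqrtr_gt0.
have rr : r ^+ 2 = y by rewrite sqr_sqrtr // ltW.
have lny : ln y = 2 * ln r by rewrite -rr lnXn // mulr_natl.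
have lny0 : 0 <= ln y by apply: ln_ge0; lra.
have ln_prime p : p \in primes_leq n ->
    ln y <= 2 * ln p%:R + (if p%:R <= r then ln y else 0).
  rewrite mem_primes_leq => /andP[/prime_gt0 p0 _]; have [pr|rp] := leP p%:R r.
    by rewrite lerDr mulr_ge0 // ln_ge0 // ler1n.
  by rewrite addr0 lny ler_pM2l // ler_ln ?posrE ?ltr0n // ltW.
have small_primes : r * ln y <= 2 * y.
  by rewrite lny -rr; have := ln_sublinear r0; nra.
have ny : n%:R * ln 8 <= y * ln 8 :> R.
  by rewrite ler_wpM2r ?truncn_le ?(ltW y0) // ln_ge0 //; lra.
have count_small := count_primes_leq_le n (ltW r0).
have large_primes := sum_ln_primes_leq R n.
have size_primes : (size (primes_leq n))%:R * ln y <=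
    2 * \sum_(p <- primes_leq n) ln (p%:R : R) +
    (count (fun p => p%:R <= r) (primes_leq n))%:R * ln y.
  rewrite -count_predT !(mulr_natl (ln y)) -!(iter_addr_0 _ (ln y)).
  rewrite -!big_const_seq mulr_sumr [X in _ <= _ + X]big_mkcond -big_split.
  rewrite big_seq [leRHS]big_seq.
  exact: ler_sum.
by nra.
Qed.

(** * Valuation rings *)

(* The junk value 0^-1 = 0 makes the first conjunct necessary. *)
Definition units_of (F : fieldType) (A : {pred F}) : {pred F} :=
  fun x => [&& x != 0, x \in A & x^-1 \in A].

Section UnitsOfSubring.
Variables (F : fieldType) (A : subringClosed F).

Lemma units_of_divr_closed : divr_closed (units_of A).
Proof.
split=> [|x y /and3P[x0 Ax Ax'] /and3P[y0 Ay Ay']]; apply/and3P.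
  by rewrite invr1 oner_neq0 rpred1.
by rewrite mulf_neq0 ?invr_eq0 // invf_div !rpredM.
Qed.

HB.instance Definition _ :=
  GRing.isDivClosed.Build F (units_of A) units_of_divr_closed.

Lemma units_of_neq0 x : x \in units_of A -> x != 0.
Proof. by case/and3P. Qed.

Lemma mem_units_of x : x \in units_of A -> x \in A.
Proof. by case/and3P. Qed.

Lemma monic_root_mem (q : {poly F}) (b : F) : q \is monic ->
  q \is a polyOver A -> root q b -> b^-1 \in A -> b \in A.
Proof.
move=> q_monic /polyOverP Aq /rootP qb Ab'.
have [->|b0] := eqVneq b 0; first exact: rpred0.
have : (0 < size q)%N by rewrite size_poly_gt0 monic_neq0.
move/monicP: q_monic qb; rewrite lead_coefE horner_coef.
case: (size q) => // -[|n] /= q_monic.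
  by rewrite big_ord1 q_monic mulr1 => /eqP; rewrite oner_eq0.
rewrite big_ord_recr /= q_monic mul1r => /eqP.
rewrite addrC addr_eq0 => /eqP bE _.
have -> : b = - \sum_(i < n.+1) q`_i * b^-1 ^+ (n - i).
  apply: (mulIf (expf_neq0 n b0)); rewrite -exprS bE mulNr mulr_suml.
  congr (- _); apply: eq_bigr => i _; rewrite -mulrA exprVn; congr (_ * _).
  have ilen : (i <= n)%N by rewrite -ltnS.
  by rewrite mulrC -expfB_cond ?(negPf b0) ?leq_subr // subKn.
by rewrite rpredN rpred_sum // => i _; rewrite rpredM ?rpredX.
Qed.

Lemma char_poly_over (n : nat) (M : 'M[F]_n) :
  M \is a mxOver A -> char_poly M \is a polyOver A.
Proof.
move=> /mxOverP AM; apply: rpred_sum => s _; apply: rpredM.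
  by rewrite rpredX // rpredN rpred1.
by apply: rpred_prod => i _; rewrite !mxE rpredB ?rpredMn ?polyOverX ?polyOverC.
Qed.

End UnitsOfSubring.

Section Adjoin.
Variables (F : fieldType) (A : subringClosed F) (x : F).

Definition adjoin : {pred F} :=
  fun z => `[< exists2 q : {poly F}, q \is a polyOver A & z = q.[x] >].

Lemma adjoinP z :
  reflect (exists2 q : {poly F}, q \is a polyOver A & z = q.[x]) (z \in adjoin).
Proof. exact: asboolP. Qed.

Lemma adjoin_subring_closed : subring_closed adjoin.
Proof.
split=> [|_ _ /adjoinP[q Aq ->] /adjoinP[r Ar ->]
         |_ _ /adjoinP[q Aq ->] /adjoinP[r Ar ->]]; apply/adjoinP.
- by exists 1; rewrite ?rpred1 ?hornerC.
- by exists (q - r); rewrite ?rpredB ?hornerE.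
- by exists (q * r); rewrite ?rpredM ?hornerM.
Qed.

HB.instance Definition _ :=
  GRing.isSubringClosed.Build F adjoin adjoin_subring_closed.

Lemma sub_adjoin : {subset A <= adjoin}.
Proof.
by move=> a Aa; apply/adjoinP; exists a%:P; rewrite ?polyOverC ?hornerC.
Qed.

Lemma adjoin_id : x \in adjoin.
Proof. by apply/adjoinP; exists 'X; rewrite ?polyOverX ?hornerX. Qed.

End Adjoin.

Lemma subring_closed_bigcup (R : pzRingType) (C : set (set R)) :
  (forall S, C S -> subring_closed [in S]) -> total_on C subset ->
  C !=set0 -> subring_closed [in \bigcup_(S in C) S].
Proof.
move=> C_subring C_chain [S0 CS0].
have common x y : x \in \bigcup_(S in C) S -> y \in \bigcup_(S in C) S ->
    exists2 S, C S & x \in S /\ y \in S.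
  move=> /set_mem[S CS Sx] /set_mem[S' CS' S'y].
  have [SS'|S'S] := C_chain _ _ CS CS'; [exists S'|exists S] => //.
    by split; apply: mem_set => //; exact: SS'.
  by split; apply: mem_set => //; exact: S'S.
have sub S : C S -> {subset S <= \bigcup_(S in C) S}.
  by move=> CS z /set_mem Sz; apply: mem_set; exists S.
split=> [|x y Ux Uy|x y Ux Uy].
- by apply: (sub _ CS0); case: (C_subring _ CS0).
- have [S CS [Sx Sy]] := common _ _ Ux Uy; apply: (sub _ CS).
  by have [_ SB _] := C_subring _ CS; exact: SB.
- have [S CS [Sx Sy]] := common _ _ Ux Uy; apply: (sub _ CS).
  by have [_ _ SM] := C_subring _ CS; exact: SM.
Qed.

Lemma eigenvalue_over_mem (F : fieldType) (A : subringClosed F) (n : nat)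
    (M : 'M[F]_n) (b : F) :
  M \is a mxOver A -> eigenvalue M b -> b^-1 \in A -> b \in A.
Proof.
rewrite eigenvalue_root_char => /char_poly_over.
exact/monic_root_mem/char_poly_monic.
Qed.

(* For [N = size q + size r], multiplication by [b] maps each of the powers
   [x ^+ i] with [i < N] to a combination of these powers over [A]. *)
Lemma mem_adjoin_inv (F : fieldType) (A : subringClosed F) (b x : F) :
  x != 0 -> b \in adjoin A x -> b \in adjoin A x^-1 -> b^-1 \in A -> b \in A.
Proof.
move=> x0 /adjoinP[q Aq bq] /adjoinP[r Ar br] Ab'.
have [->|b0] := eqVneq b 0; first exact: rpred0.
pose N := (size q + size r)%N.
have mulb_power (i : 'I_N) : exists t : {poly F},
    [/\ t \is a polyOver A, (size t <= N)%N & t.[x] = b * x ^+ i].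
  have [ir|ri] := ltnP i (size r).
    exists (q * 'X^i); rewrite rpredM ?polyOverXn // hornerM hornerXn -bq.
    split=> //; apply: leq_trans (size_polyMleq _ _) _.
    by rewrite size_polyXn addnS leq_add2l ltnW.
  exists (\poly_(k < i.+1) r`_(i - k)); split.
  - by apply: polyOver_poly => k _; apply: (polyOverP Ar).
  - exact: leq_trans (size_poly _ _) _.
  - rewrite horner_poly br (horner_coef_wide _ (leqW ri)) mulr_suml.
    rewrite (reindex_inj rev_ord_inj); apply: eq_bigr => k _ /=.
    have ki : (k <= i)%N by rewrite -ltnS.
    rewrite subSS subKn // exprVn -mulrA [_^-1 * _]mulrC.
    by rewrite -expfB_cond ?(negPf x0).
have [t ht] := choice mulb_power.
apply: (@eigenvalue_over_mem _ A _ (\matrix_(k < N, i < N) (t i)`_k)) => //.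
  by apply/mxOverP => k i; rewrite mxE; have [/polyOverP] := ht i.
have N0 : (0 < N)%N.
  rewrite addn_gt0 size_poly_gt0; apply/orP; left.
  by apply: contraNneq b0 => q0; rewrite bq q0 horner0.
apply/eigenvalueP; exists (\row_(i < N) x ^+ i).
  apply/rowP => i; rewrite !mxE; have [_ /horner_coef_wide -> <-] := ht i.
  by apply: eq_bigr => k _; rewrite !mxE mulrC.
by apply/eqP => /rowP/(_ (Ordinal N0)); rewrite !mxE => /eqP; rewrite oner_eq0.
Qed.

Section SubringAvoiding.
Variables (F : pzRingType) (B : {pred F}) (b : F).

Definition subring_avoiding (S : set F) : Prop :=
  [/\ subring_closed [in S], {subset B <= S} & b \notin S].

Lemma subring_avoiding_set (A : subringClosed F) :
  {subset B <= A} -> b \notin A -> subring_avoiding [set` A].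
Proof.
have setE x : (x \in [set` A]) = (x \in A) := asboolb (x \in A).
move=> BA nA; split=> [|x /BA|]; rewrite ?setE //.
have in_setE x : (x \in [in [set` A]]) = (x \in A) := setE x.
by split=> [|x y|x y]; rewrite !in_setE;
  [exact: rpred1|exact: rpredB|exact: rpredM].
Qed.

Lemma subring_avoiding_bigcup (C : set (set F)) :
  (forall S, C S -> subring_avoiding S) -> total_on C subset -> C !=set0 ->
  subring_avoiding (\bigcup_(S in C) S).
Proof.
move=> C_avoiding C_chain C_neq0; split.
- by apply: subring_closed_bigcup => // S /C_avoiding[].
- move=> x Bx; have [S CS] := C_neq0; have [_ BS _] := C_avoiding S CS.
  by apply/mem_set; exists S => //; exact/set_mem/BS.
- by apply/negP => /set_mem[S /C_avoiding[_ _ /negP nS]] /mem_set/nS.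
Qed.

End SubringAvoiding.

Section Chevalley.
Variables (F : fieldType) (B : subringClosed F) (a : F).
Hypotheses (Ba : a \in B) (Ba' : a^-1 \notin B).

Lemma maximal_subring_avoiding : exists A : subringClosed F,
  [/\ {subset B <= A}, a^-1 \notin A &
      forall D : subringClosed F, {subset A <= D} -> a^-1 \notin D ->
        {subset D <= A}].
Proof.
pose P := subring_avoiding B a^-1.
have PB : P [set` B] by exact: subring_avoiding_set.
pose sub (X Y : {S | P S}) := `[< sval X `<=` sval Y >].
have [X|X Y Z /asboolP XY /asboolP YZ|C C_chain|[A PA] maxA] :=
    @ZL_preorder _ (exist P _ PB) sub.
- exact/asboolP.
- by apply/asboolP => z /XY; exact: YZ.
- have [C_neq0|C0] := pselect (C !=set0); last first.
    by exists (exist P _ PB) => X CX; case: C0; exists X.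
  have PU : P (\bigcup_(S in sval @` C) S).
    apply: subring_avoiding_bigcup; last exact: image_nonempty.
      by move=> _ [X _ <-]; exact: svalP.
    move=> _ _ [X CX <-] [Y CY <-].
    by case: (C_chain _ _ CX CY) => /asboolP; [left|right].
  exists (exist P _ PU) => X CX; apply/asboolP => x Xx.
  by exists (sval X) => //; exists X.
- have [subA BA nA] := PA.
  pose A' : subringClosed F :=
    HB.pack (fun x => x \in A) (GRing.isSubringClosed.Build F _ subA).
  exists A'; split=> // D AD nD z Dz.
  have PD : P [set` D] by apply: subring_avoiding_set => // b /BA/AD.
  have /asboolP DA : sub (exist P _ PD) (exist P A PA).
    by apply: maxA; apply/asboolP => y Ay; apply/AD/mem_set.
  exact/mem_set/DA.
Qed.

Lemma chevalley_valuation_ring : exists A : subringClosed F,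
  [/\ {subset B <= A}, a^-1 \notin A & forall x, x \in A \/ x^-1 \in A].
Proof.
have [A [BA nA maxA]] := maximal_subring_avoiding.
exists A; split=> // x.
have [->|x0] := eqVneq x 0; first by left; rewrite rpred0.
have [nx|Ax] := boolP (a^-1 \in adjoin A x); last first.
  by left; apply: maxA Ax _ (adjoin_id A x); exact: sub_adjoin.
have [nx'|Ax'] := boolP (a^-1 \in adjoin A x^-1); last first.
  by right; apply: maxA Ax' _ (adjoin_id A x^-1); exact: sub_adjoin.
by case/negP: nA; apply: mem_adjoin_inv x0 nx nx' _; rewrite invrK BA.
Qed.

End Chevalley.

(** * Valuation rings above a prime number *)

Definition valuation_ring_above (F : fieldType) (p : nat)
    (A : {pred F}) : Prop :=
  p%:R^-1 \notin A /\ forall x, x \in A \/ x^-1 \in A.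

Section IntRange.
Variable R : pzRingType.

Definition int_range : {pred R} := fun x => `[< exists z : int, x = z%:~R >].

Lemma int_range_subring_closed : subring_closed int_range.
Proof.
split=> [|_ _ /asboolP[y ->] /asboolP[z ->]|_ _ /asboolP[y ->] /asboolP[z ->]];
  apply/asboolP.
- by exists 1.
- by exists (y - z); rewrite rmorphB.
- by exists (y * z); rewrite rmorphM.
Qed.

HB.instance Definition _ :=
  GRing.isSubringClosed.Build R int_range int_range_subring_closed.

End IntRange.

Lemma valuation_ring_above_exists (F : numFieldType) (p : nat) : (1 < p)%N ->
  exists A : subringClosed F, valuation_ring_above p A.
Proof.
move=> p1; have p0 : p%:R != 0 :> F by rewrite pnatr_eq0; case: p p1.
have [||A [_ nA totA]] := @chevalley_valuation_ring F (@int_range F) p%:R.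
- by apply/asboolP; exists p.
- apply/asboolP => -[z zE]; have : z * p%:Z = 1.
    by apply: (@intr_inj F); rewrite rmorphM /= -zE mulVf.
  move=> /(congr1 absz)/eqP; rewrite abszM /= muln_eq1 => /andP[_ /eqP pE].
  by rewrite pE in p1.
- by exists A.
Qed.

Lemma map_poly_ratr_int (F : numFieldType) (q : {poly int}) :
  map_poly ratr (map_poly intr q) = map_poly intr q :> {poly F}.
Proof.
by rewrite -map_poly_comp; apply: eq_map_poly => z /=; exact: ratr_int.
Qed.

Lemma size_map_intr_poly (F : numFieldType) (q : {poly int}) :
  size (map_poly intr q : {poly F}) = size q.
Proof. by rewrite size_map_inj_poly //; exact: intr_inj. Qed.

Lemma map_intr_poly_eq0 (F : numFieldType) (q : {poly int}) :
  (map_poly intr q == 0 :> {poly F}) = (q == 0).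
Proof. by rewrite -!size_poly_eq0 size_map_intr_poly. Qed.

Lemma root_intr_size_gt1 (F : numFieldType) (q : {poly int}) (b : F) :
  q != 0 -> root (map_poly intr q) b -> (1 < size q)%N.
Proof.
by rewrite -(map_intr_poly_eq0 F) -(size_map_intr_poly F); exact: root_size_gt1.
Qed.

Lemma algebraicOver_int (F : numFieldType) (b : F) : algebraicOver ratr b ->
  exists2 q : {poly int}, q != 0 & root (map_poly intr q) b.
Proof.
move=> [q0 q0_neq0 q0b]; have [q [a a0 qE]] := rat_poly_scale q0.
exists q.
  by apply: contraNneq q0_neq0 => q_eq0; rewrite qE q_eq0 map_poly0 scaler0.
by move: q0b; rewrite qE map_polyZ rootZ ?fmorph_eq0 ?invr_eq0 ?intr_eq0 //
  map_poly_ratr_int.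
Qed.

Section ValuationRingAbove.
Variables (F : numFieldType) (p : nat) (A : subringClosed F).
Hypotheses (p_prime : prime p) (A_above : valuation_ring_above p A).

Let pV_notin : p%:R^-1 \notin A. Proof. by case: A_above. Qed.
Let A_total x : x \in A \/ x^-1 \in A. Proof. by case: A_above. Qed.
Let p_neq0 : p%:R != 0 :> F. Proof. by rewrite pnatr_eq0 -lt0n prime_gt0. Qed.

(* With u c + v p = 1, either 1 / p = u (c / p) + v or 1 / c = u + v (p / c). *)
Lemma int_units_of (c : int) : ~~ (p %| c)%Z -> c%:~R \in units_of A.
Proof.
move=> pc; have c0 : c%:~R != 0 :> F.
  by rewrite intr_eq0; apply: contraNneq pc => ->; rewrite dvdz0.
have /coprimezP[[u v] /= /(congr1 (fun z : int => z%:~R : F))] : coprimez c p.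
  by rewrite coprimez_sym coprimezE prime_coprime.
rewrite rmorphD !rmorphM rmorph1 /= => bezout.
apply/and3P; split; rewrite ?rpred_int //.
have [Acp|Apc] := A_total (c%:~R / p%:R).
  case/negP: pV_notin; have -> : p%:R^-1 = u%:~R * (c%:~R / p%:R) + v%:~R :> F.
    by apply: (mulIf p_neq0); rewrite mulVf // -[LHS]bezout; field.
  by rewrite rpredD ?rpred_int // rpredM ?rpred_int.
have -> : c%:~R^-1 = u%:~R + v%:~R * (p%:R / c%:~R) :> F.
  by apply: (mulIf c0); rewrite mulVf // -[LHS]bezout; field; rewrite c0.
by rewrite rpredD ?rpred_int // rpredM ?rpred_int // -invf_div.
Qed.

Lemma ratr_mem_dvd_denq (x : rat) : ratr x \in A -> ~~ (p %| denq x)%Z.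
Proof.
move=> Ax; apply/negP => /dvdzP[e de].
have pn : ~~ (p %| numq x)%Z.
  apply/negP; rewrite dvdzE /= => pn; have := coprime_num_den x.
  by rewrite de abszM => /(coprime_dvdl pn); rewrite prime_coprime // dvdn_mull.
have /and3P[n0 _ An'] := int_units_of pn.
case/negP: pV_notin; have -> : p%:R^-1 = ratr x * e%:~R * (numq x)%:~R^-1 :> F.
  have d0 := denq_neq0 x; rewrite de mulf_eq0 -(intr_eq0 F) negb_or in d0.
  case/andP: d0 => e0 _.
  by rewrite /ratr de rmorphM /=; field; rewrite n0 e0 p_neq0.
by rewrite rpredM // rpredM // rpred_int.
Qed.

Definition nonunits : {pred F} := fun x => (x == 0) || (x^-1 \notin A).

Lemma nonunitsD x y : x \in nonunits -> y \in nonunits -> x + y \in nonunits.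
Proof.
have div_mem u v : v != 0 -> v^-1 \notin A -> u / v \in A -> u + v \in nonunits.
  move=> v0 nv Auv; apply/norP => -[s0 /negPn As]; case/negP: nv.
  have -> : v^-1 = (u / v + 1) * (u + v)^-1 by field; rewrite s0 v0.
  by rewrite rpredM ?rpredD ?rpred1.
move=> /orP[/eqP ->|nx]; first by rewrite add0r.
move=> /orP[/eqP ->|ny]; first by rewrite addr0; apply/orP; right.
have [->|x0] := eqVneq x 0; first by rewrite add0r; apply/orP; right.
have [->|y0] := eqVneq y 0; first by rewrite addr0; apply/orP; right.
have [|h] := A_total (x / y); first exact: div_mem.
by rewrite addrC; apply: div_mem; rewrite // -invf_div.
Qed.

Lemma nonunits_sum (I : Type) (r : seq I) (P : pred I) (f : I -> F) :
  (forall i, P i -> f i \in nonunits) -> \sum_(i <- r | P i) f i \in nonunits.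
Proof.
move=> h; elim/big_ind: _ => //; last exact: nonunitsD.
by rewrite /in_mem /= /nonunits eqxx.
Qed.

(* Two terms of least valuation must cancel in a vanishing sum. *)
Lemma vanishing_sum_unit_ratio (I : finType) (t : I -> F) (i0 : I) :
  t i0 != 0 -> \sum_i t i = 0 ->
  exists i j, i != j /\ t i / t j \in units_of A.
Proof.
move=> ti0 sum0; pose divides := [rel x y | y / x \in A].
have [||||j tj minj] := @extremum_inP _ _ divides i0 (fun i => t i != 0) t.
- by move=> i ti; rewrite /= divff // rpred1.
- move=> j i k tj _ _ /= Aji Akj.
  by rewrite -(divfK tj (t k)) -(mulrA (t k / t j)) rpredM.
- move=> i j _ _ /=; rewrite -[t i / t j]invf_div; apply/orP.
  exact: A_total.
- by [].
have tj_min i : t i / t j \in A.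
  by have [->|/minj//] := eqVneq (t i) 0; rewrite mul0r rpred0.
apply: contrapT => none; have : -1 \in nonunits.
  have -> : -1 = \sum_(i | i != j) t i / t j.
    apply: (mulIf tj); rewrite mulr_suml (eq_bigr t) => [|i _].
      move/eqP: sum0; rewrite (bigD1 j) //= addr_eq0 => /eqP ->.
      by rewrite mulN1r opprK.
    by rewrite divfK.
  apply: nonunits_sum => i ij; apply/norP => -[tij /negPn Atij].
  by apply: none; exists i, j; split=> //; apply/and3P.
rewrite /in_mem /= /nonunits oppr_eq0 oner_eq0 invrN1 => /negP; apply.
by rewrite rpredN rpred1.
Qed.

Lemma int_units_of_expz (c : int) : c != 0 ->
  exists k : int, c%:~R * p%:R ^ k \in units_of A.
Proof.
move=> c0; have c_gt0 : (0 < `|c|)%N by rewrite absz_gt0.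
have [m pm cm] := pfactor_coprime p_prime c_gt0.
have cE : c = (-1) ^+ (c < 0)%R * m%:Z * (p ^ logn p `|c|)%N%:Z.
  by rewrite -mulrA -PoszM -cm -intEsign.
exists (- (logn p `|c|)%:Z); suff -> : c%:~R * p%:R ^ (- (logn p `|c|)%:Z) =
    ((-1) ^+ (c < 0)%R * m%:Z)%:~R :> F.
  by apply: int_units_of; rewrite dvdzE abszMsign -prime_coprime.
rewrite -invr_expz -exprnP {1}cE rmorphM /= -pmulrn natrX mulfK //.
by rewrite expf_neq0.
Qed.

(* The value group of the algebraic numbers is torsion modulo the value of p. *)
Lemma algebraic_units_of_expz (b : F) : b != 0 -> algebraicOver ratr b ->
  exists e k : int, e != 0 /\ b ^ e * p%:R ^ k \in units_of A.
Proof.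
move=> b0 /algebraicOver_int[q q0 /rootP]; rewrite /map_poly horner_poly.
pose t (i : 'I_(size q)) : F := (q`_i)%:~R * b ^+ i; rewrite -/(\sum_i t i).
have lead_lt : ((size q).-1 < size q)%N by rewrite prednK // size_poly_gt0.
move=> /(@vanishing_sum_unit_ratio _ t (Ordinal lead_lt))[|i [j [ij u]]].
  by rewrite mulf_neq0 ?expf_neq0 // intr_eq0 -lead_coefE lead_coef_eq0.
have := units_of_neq0 u; rewrite mulf_eq0 invr_eq0 /t !mulf_eq0 !intr_eq0.
rewrite !expf_eq0 (negPf b0) !andbF !orbF negb_or => /andP[qi0 qj0].
have [[ki ui] [kj uj]] := (int_units_of_expz qi0, int_units_of_expz qj0).
exists (i%:Z - j%:Z), (kj - ki); split; first by rewrite subr_eq0 eqz_nat.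
suff -> : b ^ (i%:Z - j%:Z) * p%:R ^ (kj - ki) =
    (t i / t j) * ((q`_j)%:~R * p%:R ^ kj) / ((q`_i)%:~R * p%:R ^ ki).
  by rewrite rpred_div // rpredM.
rewrite !expfzDr // -!invr_expz -!exprnP /t.
by field; rewrite !intr_eq0 qi0 qj0 !expf_neq0 ?expfz_neq0.
Qed.

Lemma root_mem_above (q : {poly int}) (b : F) :
  ~~ (p %| lead_coef q)%Z -> root (map_poly intr q) b -> b \in A.
Proof.
move=> /int_units_of/and3P[l0 Al Al'] qb.
have [//|Ab'] := A_total b.
pose lF : F := (lead_coef q)%:~R.
have lE : lead_coef (map_poly intr q : {poly F}) = lF.
  by rewrite lead_coef_map_inj //; exact: intr_inj.
apply: (@monic_root_mem _ A (lF^-1 *: map_poly intr q)) => //.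
- by rewrite monicE lead_coefZ lE mulVf.
- by apply/polyOverP => i; rewrite coefZ coef_map rpredM ?rpred_int.
- by rewrite rootZ ?invr_eq0.
Qed.

Lemma root_units_of (q : {poly int}) (b : F) :
  ~~ (p %| lead_coef q)%Z -> ~~ (p %| q`_0)%Z -> root (map_poly intr q) b ->
  b \in units_of A.
Proof.
move=> pl pq0 qb; have Ab := root_mem_above pl qb.
move: pq0 qb => {pl}; elim/poly_ind: q => [|h c _].
  by rewrite coef0 dvdz0.
rewrite coefD coefMX coefC add0r /= => /int_units_of/and3P[c0 Ac Ac'].
rewrite rmorphD rmorphM /= map_polyX map_polyC /= => /rootP.
rewrite !hornerE /= => /eqP; rewrite addr_eq0 => /eqP hb.
have b0 : b != 0.
  by apply: contraNneq c0 => b0; move/eqP: hb; rewrite b0 mulr0 eq_sym oppr_eq0.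
apply/and3P; split=> //.
have -> : b^-1 = - ((map_poly intr h).[b] / c%:~R).
  by apply: (mulIf b0); rewrite mulVf // mulNr mulrAC hb mulNr divff // opprK.
rewrite rpredN rpredM // rpred_horner //.
by apply/polyOverP => i; rewrite coef_map rpred_int.
Qed.

End ValuationRingAbove.

Lemma ratr_mem_int (F : numFieldType) (A : nat -> subringClosed F) (x : rat) :
  (forall p, prime p -> valuation_ring_above p (A p)) ->
  (forall p, prime p -> ratr x \in A p) -> x \is a Num.int.
Proof.
move=> A_above Ax; rewrite Qint_def -[denq x]gez0_abs // -[1]/(1%:Z) eqz_nat.
apply: contraT => d1; have /pdivP[p pp pd] : (1 < `|denq x|)%N.
  by rewrite ltn_neqAle eq_sym d1 absz_gt0 denq_neq0.
by have := ratr_mem_dvd_denq pp (A_above _ pp) (Ax _ pp); rewrite dvdzE pd.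
Qed.

Lemma valuation_rings_above_exist (F : numFieldType) :
  exists A : nat -> subringClosed F,
    forall p, prime p -> valuation_ring_above p (A p).
Proof.
have [A2 _] := @valuation_ring_above_exists F 2 isT.
suff /choice[A hA] p : exists A : subringClosed F,
    prime p -> valuation_ring_above p A by exists A.
have [pp|_] := boolP (prime p); last by exists A2.
by have [A hA] := @valuation_ring_above_exists F p (prime_gt1 pp); exists A.
Qed.

(** * Values of polynomials at the roots of a polynomial *)

Section ValuesOnRoots.
Variables (k : fieldType) (F : closedFieldType) (iota : {rmorphism k -> F}).
Local Notation "p ^iota" := (map_poly iota p) (at level 2, format "p ^iota").

Lemma horner_inv_on_roots (g v : {poly k}) :
  (forall r, root g^iota r -> v^iota.[r] != 0) ->
  exists w : {poly k}, forall r, root g^iota r -> w^iota.[r] = v^iota.[r]^-1.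
Proof.
move=> /Pdiv.ClosedField.coprimepP; rewrite coprimep_map.
move=> /Bezout_eq1_coprimepP[[s w] /= bezout]; exists w => r /rootP gr.
apply/esym/mulr1_eq; rewrite mulrC -hornerM -rmorphM /=.
have <- : (s * g + w * v)^iota.[r] = 1 by rewrite bezout rmorph1 hornerC.
by rewrite rmorphD rmorphM hornerD hornerM /= gr mulr0 add0r.
Qed.

Lemma horner_prod_expz_on_roots (I : finType) (g : {poly k})
    (u : I -> {poly k}) (e : I -> int) :
  (forall i r, root g^iota r -> (u i)^iota.[r] != 0) ->
  exists h : {poly k}, forall r, root g^iota r ->
    h^iota.[r] = \prod_i (u i)^iota.[r] ^ e i.
Proof.
move=> u_neq0; have /choice[h hE] i : exists h : {poly k},
    forall r, root g^iota r -> h^iota.[r] = (u i)^iota.[r] ^ e i.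
  case: (e i) => m.
    by exists (u i ^+ m) => r _; rewrite rmorphXn horner_exp.
  have [w wE] := horner_inv_on_roots (u_neq0 i).
  by exists (w ^+ m.+1) => r gr; rewrite rmorphXn horner_exp wE // NegzE exprVn.
exists (\prod_i h i) => r gr; rewrite rmorph_prod horner_prod.
by apply: eq_bigr => i _; rewrite hE.
Qed.

Lemma eigenvector_horner_mx (n : nat) (M : 'M[F]_n.+1) (v : 'rV_n.+1)
    (r : F) (h : {poly F}) :
  v *m M = r *: v -> v *m horner_mx M h = h.[r] *: v.
Proof.
move=> vM; elim/poly_ind: h => [|h c IH].
  by rewrite rmorph0 mulmx0 horner0 scale0r.
rewrite rmorphD rmorphM /= horner_mx_X horner_mx_C mulmxDr mulmxA IH.
rewrite -scalemxAl vM scalerA mul_mx_scalar -scalerDl.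
by rewrite hornerD hornerM hornerX hornerC.
Qed.

Lemma root_char_poly_horner_mx (n : nat) (M : 'M[F]_n.+1) (h : {poly F}) z :
  root (char_poly (horner_mx M h)) z <->
  exists2 r, root (char_poly M) r & z = h.[r].
Proof.
split=> [|[r]]; rewrite -!eigenvalue_root_char; last first.
  move/eigenvalueP=> [v vM v0] ->; apply/eigenvalueP; exists v => //.
  exact: eigenvector_horner_mx.
move/eigenvalueP=> [v vh v0]; apply: contrapT => none.
have /Pdiv.ClosedField.coprimepP : forall r, root (char_poly M) r ->
    (h - z%:P).[r] != 0.
  move=> r rM; rewrite !hornerE subr_eq0; apply/negP => /eqP e.
  by apply: none; exists r.
move=> /Bezout_eq1_coprimepP[[s t] /=].
rewrite [t * _]mulrC => /(congr1 (horner_mx M)).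
rewrite rmorphD !rmorphM rmorph1 /= Cayley_Hamilton mulr0 add0r rmorphB /=.
rewrite horner_mx_C => /(congr1 (mulmx v)).
rewrite mulmx1 mulmxA mulmxBr vh mul_mx_scalar subrr mul0mx => v0'.
by rewrite -v0' eqxx in v0.
Qed.

Lemma poly_of_values_on_roots (g h : {poly k}) : (1 < size g)%N ->
  exists X : {poly k}, [/\ X \is monic, size X = size g &
    forall z, root X^iota z <-> exists2 r, root g^iota r & z = h^iota.[r]].
Proof.
move=> g1; have l0 : lead_coef g != 0.
  by rewrite lead_coef_eq0 -size_poly_gt0 ltnW.
pose q := (lead_coef g)^-1 *: g.
have q_monic : q \is monic by rewrite monicE lead_coefZ mulVf.
have sq : size q = size g by rewrite size_scale ?invr_eq0.
have [m [M ME]] : exists m (M : 'M[k]_m.+1), char_poly M = q.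
  have := companionmxK q_monic; have : (0 < (size q).-1)%N.
    by rewrite sq; case: (size g) g1 => [|[]].
  by move: (companionmx q); case: (size q).-1 => // m M _ <-; exists m, M.
exists (char_poly (horner_mx M h)); split; first exact: char_poly_monic.
  by rewrite -sq -ME !size_char_poly.
move=> z; rewrite map_char_poly map_horner_mx root_char_poly_horner_mx.
rewrite -map_char_poly ME /q map_polyZ.
by split=> -[r]; rewrite ?rootZ ?fmorph_eq0 ?invr_eq0 // => gr ->; exists r;
  rewrite ?rootZ ?fmorph_eq0 ?invr_eq0.
Qed.

End ValuesOnRoots.

Lemma finite_bounded_int_polys (d K : nat) : finite_set
  [set q : {poly int} | (size q <= d)%N /\ forall i, (`|(q`_i)%R| <= K)%N].
Proof.
pose P (c : 'rV['I_(2 * K).+1]_d) : {poly int} :=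
  rVpoly (map_mx (fun j : 'I_(2 * K).+1 => j%:Z - K%:Z) c).
apply: (@sub_finite_set _ _ (range P)); last exact/finite_image/finite_finset.
move=> q [qd qK].
exists (map_mx (fun z : int => inord `|(z + K%:Z)%R|%N) (poly_rV q)) => //.
rewrite /P -[RHS](poly_rV_K qd); congr rVpoly; apply/rowP => i; rewrite !mxE.
have := qK i; move: (q`_i) => z zK.
by rewrite inordK; lia.
Qed.

Lemma closed_field_distinct_roots (F : closedFieldType) (p : {poly F}) :
  p != 0 ->
  exists s : seq F,
    [/\ uniq s, (size s < size p)%N & forall z, (z \in s) = root p z].
Proof.
move=> p0; have [s pE] := closed_field_poly_normal p; exists (undup s).
have mem_s z : (z \in undup s) = root p z.
  by rewrite mem_undup pE rootZ ?lead_coef_eq0 // root_prod_XsubC.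
split; rewrite ?undup_uniq //; apply: max_poly_roots => //.
  by apply/allP => z; rewrite mem_s.
exact: undup_uniq.
Qed.

Lemma finite_roots (F : closedFieldType) (p : {poly F}) : p != 0 ->
  finite_set [set z | root p z].
Proof.
move=> /closed_field_distinct_roots[s [_ _ sE]].
by apply/finite_seqP; exists s; apply/seteqP; split=> z /=; rewrite sE.
Qed.

Lemma coef_prod_XsubC_norm (F : numFieldType) (b : F) (s : seq F) (i : nat) :
  0 <= b -> (forall r, r \in s -> `|r| <= b) ->
  `|(\prod_(r <- s) ('X - r%:P))`_i| <= (1 + b) ^+ size s.
Proof.
move=> b0; elim: s i => [|a s IH] i sb.
  by rewrite big_nil coef1 expr0; case: eqP => _; rewrite ?normr1 ?normr0.
have IHs j : `|(\prod_(r <- s) ('X - r%:P))`_j| <= (1 + b) ^+ size s.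
  by apply: IH => r rs; apply: sb; rewrite in_cons rs orbT.
rewrite big_cons mulrBl coefB coefXM coefCM /= exprS mulrDl mul1r.
apply: le_trans (ler_normB _ _) _; apply: lerD.
  by case: ifP => // _; rewrite normr0 exprn_ge0 // addr_ge0.
by rewrite normrM; apply: ler_pM => //; apply: sb; rewrite mem_head.
Qed.

Lemma monic_int_coef_bound (F : numClosedFieldType) (b : nat) (X : {poly int})
    (i : nat) :
  X \is monic ->
  (forall z : F, root (map_poly intr X) z -> `|z| <= b%:R) ->
  (`|(X`_i)%R| <= b.+1 ^ (size X).-1)%N.
Proof.
move=> X_monic Xb.
have [s] := closed_field_poly_normal (map_poly intr X : {poly F}).
rewrite (monicP (monic_map _ X_monic)) scale1r => XE.
have sX : size s = (size X).-1.
  by rewrite -(size_map_intr_poly F) XE size_prod_XsubC.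
have : `|(X`_i)%:~R| <= (1 + b%:R) ^+ size s :> F.
  rewrite -[_%:~R]/(intr _) -coef_map XE.
  apply: coef_prod_XsubC_norm => // z zs; apply: Xb.
  by rewrite XE root_prod_XsubC.
by rewrite sX nat1r -natrX -intr_norm pmulrn ler_int -lez_nat abszE.
Qed.

Section IntegralOnRoots.
Variables (F : numClosedFieldType) (g : {poly int}).
Variable A : nat -> subringClosed F.
Hypothesis g_nonconst : (1 < size g)%N.
Hypothesis A_above : forall p, prime p -> valuation_ring_above p (A p).

Definition integral_on_roots (h : {poly rat}) : Prop :=
  forall (p : nat) (r : F), prime p -> root (map_poly intr g) r ->
    (map_poly ratr h).[r] \in A p.

Lemma int_poly_of_values_on_roots (h : {poly rat}) : integral_on_roots h ->
  exists X : {poly int}, [/\ X \is monic, size X = size g &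
    forall z : F, root (map_poly intr X) z <->
      exists2 r, root (map_poly intr g) r & z = (map_poly ratr h).[r]].
Proof.
move=> h_int; have := @poly_of_values_on_roots _ F ratr (map_poly intr g) h.
rewrite size_rat_int_poly => /(_ g_nonconst)[X []].
rewrite map_poly_ratr_int => X_monic sX rootX.
have [s XE] := closed_field_poly_normal (map_poly ratr X : {poly F}).
rewrite (monicP (monic_map _ X_monic)) scale1r in XE.
have X_int i : X`_i \is a Num.int.
  apply: (ratr_mem_int A_above) => p pp; rewrite -coef_map /= XE.
  apply/polyOverP: i; rewrite big_seq rpred_prod // => z zs.
  have /rootX[r gr ->] : root (map_poly ratr X) z by rewrite XE root_prod_XsubC.
  by rewrite polyOverXsubC h_int.
have X_floor : X = map_poly intr (map_poly Num.floor X).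
  by apply/polyP => i; rewrite coef_map /= coef_map_id0 ?floor0 // floorK.
exists (map_poly Num.floor X); rewrite X_floor in X_monic sX rootX.
split=> [||z]; last by rewrite -rootX map_poly_ratr_int.
  rewrite monicE lead_coef_map_inj // in X_monic; last exact: intr_inj.
  by rewrite monicE -(eqr_int rat).
by rewrite -sX size_rat_int_poly.
Qed.

Lemma finite_integral_values (b : nat) : finite_set [set z : F |
  exists h r, [/\ integral_on_roots h,
    forall r' : F, root (map_poly intr g) r' ->
      `|(map_poly ratr h).[r']| <= b%:R,
    root (map_poly intr g) r & z = (map_poly ratr h).[r]]].
Proof.
pose K := (b.+1 ^ (size g).-1)%N.
pose Q := [set q : {poly int} |
  [/\ (size q <= size g)%N, forall i, (`|(q`_i)%R| <= K)%N & q \is monic]].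
apply: (@sub_finite_set _ _
    (\bigcup_(q in Q) [set z : F | root (map_poly intr q) z])).
  move=> _ [h [r [h_int hb gr ->]]].
  have [X [X_monic sX rootX]] := int_poly_of_values_on_roots h_int.
  exists X; last by apply/rootX; exists r.
  split; rewrite ?sX // => i; rewrite /K -sX.
  apply: (@monic_int_coef_bound F) => //.
  by move=> _ /rootX[r' gr' ->]; exact: hb.
apply: bigcup_finite => [|q [_ _ q_monic]].
  by apply: sub_finite_set (finite_bounded_int_polys (size g) K) => q [].
by apply: finite_roots; rewrite monic_neq0 // monic_map.
Qed.

(* A form of Kronecker's theorem: the first powers of the value of [h] at a root
   lie in a finite set that does not depend on [h]. *)
Lemma kronecker_unity_root : exists M : nat, forall h : {poly rat},
  integral_on_roots h ->
  (forall r : F, root (map_poly intr g) r ->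
     `|(map_poly ratr h).[r]| ^+ M <= 2) ->
  forall r : F, root (map_poly intr g) r -> (map_poly ratr h).[r] != 0 ->
  exists2 m, (0 < m)%N & (map_poly ratr h).[r] ^+ m = 1.
Proof.
have /finite_seqP[s sE] := finite_integral_values 2; exists (size s).
move=> h h_int hb r gr hr0; set z := (map_poly ratr h).[r].
have powE i (r' : F) :
    (map_poly ratr (h ^+ i)).[r'] = (map_poly ratr h).[r'] ^+ i.
  by rewrite rmorphXn horner_exp.
have powers_in_s i : (i <= size s)%N -> z ^+ i \in s.
  move=> ilt; suff : [set` s] (z ^+ i) by [].
  rewrite -sE; exists (h ^+ i), r; split=> // [p r' pp gr'|r' gr'].
    by rewrite powE rpredX // h_int.
  rewrite powE normrX.
  have [le1|ge1] := real_leP (normr_real (map_poly ratr h).[r']) (real1 F).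
    by apply: (@le_trans _ _ 1); rewrite ?exprn_ile1 ?ler1n.
  by apply: le_trans (hb r' gr'); rewrite ler_weXn2l // ltW.
pose powers (i : 'I_(size s).+1) := z ^+ i.
have /injectivePn[i [j ij zij]] : ~~ injectiveb powers.
  apply/negP => powers_inj; suff : (size (codom powers) <= size s)%N.
    by rewrite size_codom card_ord ltnn.
  apply: uniq_leq_size powers_inj _ => _ /mapP[i _ ->].
  by apply: powers_in_s; rewrite -ltnS.
wlog ltij : i j ij zij / (i < j)%N.
  move=> wlog_lt; have [|ji] := ltnP i j; first exact: wlog_lt ij zij.
  by apply: (wlog_lt j i); rewrite ?(eq_sym j) // ltn_neqAle eq_sym ij.
exists (j - i)%N; first by rewrite subn_gt0.
apply: (mulfI (expf_neq0 i hr0)); rewrite mulr1 -exprD subnKC //; exact: ltnW.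
Qed.

End IntegralOnRoots.

(** * Multiplicative relations between units *)

Lemma truncn_eq_dist (R : archiRealFieldType) (x y : R) : 0 <= x -> 0 <= y ->
  Num.truncn x = Num.truncn y -> `|x - y| < 1.
Proof.
move=> /truncn_itv/andP[x1 x2] /truncn_itv/andP[y1 y2] xy.
rewrite xy in x1 x2; move: x2 y2; rewrite -natr1 => x2 y2.
by rewrite ltr_norml; apply/andP; split; lra.
Qed.

Lemma box_count_lt (m n W H : nat) : (m < n)%N -> H = ((2 * W).+1 ^ m)%N ->
  ((2 * (H * W)).+1 ^ m < H.+1 ^ n)%N.
Proof.
move=> mn HE; apply: (@leq_ltn_trans (((2 * W).+1 * H.+1) ^ m)).
  have [->|m0] := posnP m; first by rewrite !expn0.
  by rewrite leq_exp2r //; nia.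
rewrite expnMn -HE.
apply: (@leq_trans (H.+1 ^ m.+1)); last by rewrite leq_pexp2l.
by rewrite expnS ltn_pmul2r // expn_gt0.
Qed.

Lemma exists_small_linear_forms (R : archiRealFieldType) (I J : finType)
    (w : I -> J -> R) : (#|J| < #|I|)%N ->
  exists f : I -> int, (exists i, f i != 0) /\
    forall j, `|\sum_i (f i)%:~R * w i j| < 1.
Proof.
move=> JI; pose W := Num.bound (\sum_j \sum_i `|w i j|).
have wW j : \sum_i `|w i j| <= W%:R.
  apply: le_trans (ltW (archi_boundP _)); last by do 2 apply: sumr_ge0 => ? _.
  by rewrite [leRHS](bigD1 j) //= lerDl; do 2 apply: sumr_ge0 => ? _.
pose H := ((2 * W).+1 ^ #|J|)%N; pose form (c : {ffun I -> 'I_H.+1}) j : R :=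
  \sum_i (c i)%:R * w i j + (H * W)%:R.
have form_itv c j : 0 <= form c j <= (2 * (H * W))%:R.
  have : `|\sum_i (c i)%:R * w i j| <= (H * W)%:R.
    apply: le_trans (ler_norm_sum _ _ _) _; rewrite natrM.
    apply: le_trans _ (ler_wpM2l (ler0n _ _) (wW j)); rewrite mulr_sumr.
    apply: ler_sum => i _; rewrite normrM normr_nat ler_wpM2r // ler_nat.
    by rewrite -ltnS.
  by rewrite ler_norml /form natrM => /andP[? ?]; apply/andP; split; lra.
pose box c : {ffun J -> 'I_(2 * (H * W)).+1} :=
  [ffun j => inord (Num.truncn (form c j))].
have /injectivePn[c [d cd box_cd]] : ~~ injectiveb box.
  apply/negP => /injectiveP/leq_card; rewrite !card_ffun !card_ord leqNgt.
  by rewrite box_count_lt.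
exists (fun i => (c i)%:Z - (d i)%:Z); split.
  have /existsP[i cdi] : [exists i, c i != d i].
    apply: contraR cd => /existsPn cd; apply/eqP/ffunP => i.
    exact/eqP/negPn/cd.
  by exists i; rewrite subr_eq0 eqz_nat.
move=> j; have -> : \sum_i ((c i)%:Z - (d i)%:Z)%:~R * w i j =
    form c j - form d j.
  rewrite /form opprD addrACA subrr addr0 -sumrB.
  by apply: eq_bigr => i _; rewrite rmorphB mulrBl.
have [/andP[c0 cH] /andP[d0 dH]] := (form_itv c j, form_itv d j).
apply: truncn_eq_dist => //.
have trunc_lt (x : R) : 0 <= x -> x <= (2 * (H * W))%:R ->
    (Num.truncn x < (2 * (H * W)).+1)%N.
  by move=> x0 xH; rewrite ltnS -(ler_nat R) (le_trans _ xH) // truncn_le.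
have := congr1 (fun b : {ffun _ -> _} => val (b j)) box_cd.
by rewrite !ffunE /= !inordK ?trunc_lt.
Qed.

Lemma expfz_sum (F : fieldType) (I : finType) (x : F) (e : I -> int) : x != 0 ->
  \prod_i x ^ e i = x ^ (\sum_i e i).
Proof.
move=> x0; apply/esym; apply: (big_morph (fun m : int => x ^ m)) => // m n.
exact: expfzDr.
Qed.

Lemma prod_expz_units_of (F : fieldType) (A : subringClosed F) (I : finType)
    (b : I -> F) (c : F) (E : int) (e f : I -> int) :
  c != 0 -> (forall i, b i ^ E * c ^ e i \in units_of A) ->
  \sum_i f i * e i = 0 -> \prod_i b i ^ (E * f i) \in units_of A.
Proof.
move=> c0 bc fe0.
suff -> : \prod_i b i ^ (E * f i) = \prod_i (b i ^ E * c ^ e i) ^ f i.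
  by apply: rpred_prod => i _; exact: rpredXz.
under [RHS]eq_bigr do rewrite expfzMl !exprz_exp [e _ * _]mulrC.
by rewrite big_split /= expfz_sum // fe0 mulr1.
Qed.

Lemma common_units_of_expz (F : numFieldType) (A : nat -> subringClosed F)
    (T : finType) (b : T -> F) (p : T -> nat) :
  (forall q, prime q -> valuation_ring_above q (A q)) ->
  (forall t, [/\ prime (p t), b t != 0 & algebraicOver ratr (b t)]) ->
  exists (E : int) (k : T -> int), E != 0 /\
    forall t, b t ^ E * (p t)%:R ^ k t \in units_of (A (p t)).
Proof.
move=> A_above hb; have /choice[ek ekP] t : exists ek : int * int,
    ek.1 != 0 /\ b t ^ ek.1 * (p t)%:R ^ ek.2 \in units_of (A (p t)).
  have [pp b0 b_alg] := hb t.
  have [e [k [e0 u]]] := algebraic_units_of_expz pp (A_above _ pp) b0 b_alg.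
  by exists (e, k).
exists (\prod_t (ek t).1), (fun t => (ek t).2 * \prod_(s | s != t) (ek s).1).
split=> [|t]; first by apply/prodf_neq0 => t _; case: (ekP t).
have [_ u] := ekP t; rewrite (bigD1 t) //= -!exprz_exp -expfzMl.
exact: rpredXz.
Qed.

Lemma algebraicOver_horner (K E : fieldType) (iota : {rmorphism K -> E})
    (h : {poly K}) (x : E) :
  algebraicOver iota x -> algebraicOver iota (map_poly iota h).[x].
Proof.
move=> /integral_algebraic x_int; apply/integral_algebraic.
apply: integral_horner x_int; apply/integral_poly => i.
by rewrite coef_map; exact: integral_id.
Qed.

Section LogNorm.
Variable R : realType.
Implicit Types z : R[i].

Definition log_norm z : R := ln (complex.Re `|z|).

Lemma Re_normE z : (complex.Re `|z|)%:C = `|z|.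
Proof. by rewrite normc_def. Qed.

Lemma Re_norm_gt0 z : z != 0 -> 0 < complex.Re `|z|.
Proof. by rewrite -normr_gt0 -Re_normE ltcR. Qed.

Lemma norm_log_norm z : z != 0 -> `|z| = (expR (log_norm z))%:C.
Proof. by move=> z0; rewrite lnK ?posrE ?Re_norm_gt0 // Re_normE. Qed.

Lemma log_norm_prod_expz (I : finType) (z : I -> R[i]) (e : I -> int) :
  (forall i, z i != 0) ->
  log_norm (\prod_i z i ^ e i) = \sum_i (e i)%:~R * log_norm (z i).
Proof.
move=> z0; have norm_expz (x : R[i]) (m : int) : `|x ^ m| = `|x| ^ m.
  by case: m => m; rewrite ?NegzE -?invr_expz ?normfV -?exprnP normrX.
have Re_norm_prod :
    complex.Re `|\prod_i z i ^ e i| = \prod_i complex.Re `|z i| ^ e i.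
  apply: (@complexI R); rewrite Re_normE normr_prod rmorph_prod.
  by apply: eq_bigr => i _; rewrite norm_expz /= fmorphXz /= Re_normE.
rewrite /log_norm Re_norm_prod ln_prod => [|i _]; last first.
  by rewrite exprz_gt0 // Re_norm_gt0.
by apply: eq_bigr => i _; rewrite -powR_intmul ?ln_powR // ltW ?Re_norm_gt0.
Qed.

Lemma norm_expn_leq2 z (M : nat) : z != 0 -> M%:R * log_norm z <= ln 2 ->
  `|z| ^+ M <= 2.
Proof.
move=> z0 zM; rewrite norm_log_norm // -rmorphXn /= -expRM_natl.
rewrite -[2]/(2%:R) -(rmorph_nat (real_complex R)) lecR.
by rewrite -[leRHS]lnK ?posrE // ler_expR.
Qed.

End LogNorm.

(* The polynomials [u i] stand for elements of the field generated by a root of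
   [g], and their values at the roots of [g] for the conjugates of these. *)
Section SUnits.
Variables (R : realType) (g : {poly int}) (A : nat -> subringClosed R[i]).
Variables (S : seq nat) (I : finType) (u : I -> {poly rat}).
Let u_at i (r : R[i]) : R[i] := (map_poly ratr (u i)).[r].
Hypothesis g_nonconst : (1 < size g)%N.
Hypothesis A_above : forall p, prime p -> valuation_ring_above p (A p).
Hypothesis S_prime : all prime S.
Hypothesis u_neq0 : forall i (r : R[i]),
  root (map_poly intr g) r -> u_at i r != 0.
Hypothesis u_unit : forall i p (r : R[i]), prime p -> p \notin S ->
  root (map_poly intr g) r -> u_at i r \in units_of (A p).

Variable rs : seq R[i].
Hypothesis rsE : forall r : R[i], (r \in rs) = root (map_poly intr g) r.

Let root_algebraic (r : R[i]) :
  root (map_poly intr g) r -> algebraicOver ratr r.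
Proof.
exists (map_poly intr g); last by rewrite map_poly_ratr_int.
by rewrite -size_poly_gt0 size_rat_int_poly ltnW.
Qed.

Lemma S_units_valuations :
  exists (E : int) (v : I -> seq_sub rs * seq_sub (undup S) -> int),
    E != 0 /\ forall f : I -> int, (forall rp, \sum_i f i * v i rp = 0) ->
      forall r p, root (map_poly intr g) r -> prime p ->
        \prod_i u_at i r ^ (E * f i) \in units_of (A p).
Proof.
pose T := (seq_sub rs * seq_sub (undup S))%type.
have rootT (t : I * T) : root (map_poly intr g) (ssval t.2.1).
  by rewrite -rsE; exact: ssvalP.
have primeT (t : I * T) : prime (ssval t.2.2).
  by apply: (allP S_prime); rewrite -mem_undup; exact: ssvalP.
have [t|E [k [E0 Ek]]] := @common_units_of_expz _ A (I * T)%type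
    (fun t => u_at t.1 (ssval t.2.1)) (fun t => ssval t.2.2) A_above.
  split; [exact: primeT|exact/u_neq0/rootT|].
  exact/algebraicOver_horner/root_algebraic/rootT.
exists E, (fun i rp => k (i, rp)); split=> // f f_ker r p gr pp.
have [pS|pS] := boolP (p \in S); last first.
  by apply: rpred_prod => i _; apply: rpredXz; exact: u_unit.
have r_rs : r \in rs by rewrite rsE.
have p_S : p \in undup S by rewrite mem_undup.
pose rp : T := (SeqSub r_rs, SeqSub p_S).
apply: (@prod_expz_units_of _ _ _ _ p%:R _ (fun i => k (i, rp))) => [|i|].
- by rewrite pnatr_eq0 -lt0n prime_gt0.
- exact: (Ek (i, rp)).
- exact: f_ker.
Qed.

Hypothesis rs_uniq : uniq rs.
Hypothesis rank_lt : (size rs * (size S).+1 < #|I|)%N.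

Lemma S_units_small_product (M : nat) :
  exists e : I -> int, (exists i, e i != 0) /\
    forall r : R[i], root (map_poly intr g) r ->
      (forall p, prime p -> \prod_i u_at i r ^ e i \in units_of (A p)) /\
      `|\prod_i u_at i r ^ e i| ^+ M <= 2.
Proof.
have [E [v [E0 v_unit]]] := S_units_valuations.
have ln2 : 0 < ln 2 :> R by apply: ln_gt0; lra.
pose w i (j : seq_sub rs * seq_sub (undup S) + seq_sub rs) : R :=
  match j with
  | inl rp => (v i rp)%:~R
  | inr r => E%:~R * (M%:R * log_norm (u_at i (ssval r))) / ln 2
  end.
have [|f [[i0 fi0] f_small]] := exists_small_linear_forms w.
  apply: leq_ltn_trans rank_lt.
  rewrite card_sum card_prod !card_seq_sub ?undup_uniq // -mulnSr.
  by rewrite leq_mul // ltnS size_undup.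
exists (fun i => E * f i); split; first by exists i0; rewrite mulf_neq0.
move=> r gr; split=> [p pp|].
  apply: v_unit => // rp; apply/eqP; have := f_small (inl rp).
  under eq_bigr do rewrite -intrM.
  rewrite -rmorph_sum -intr_norm -[1]/(1%:~R) ltr_int.
  by move: (\sum_i _) => z; lia.
apply: norm_expn_leq2.
  by apply/prodf_neq0 => i _; rewrite expfz_neq0 ?u_neq0.
have r_rs : r \in rs by rewrite rsE.
have /ltr_normlW := f_small (inr (SeqSub r_rs)).
rewrite log_norm_prod_expz => [|i]; last exact: u_neq0.
have -> : \sum_i (f i)%:~R * w i (inr (SeqSub r_rs)) =
    M%:R * (\sum_i (E * f i)%:~R * log_norm (u_at i r)) / ln 2.
  rewrite mulr_sumr mulr_suml; apply: eq_bigr => i _.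
  by rewrite intrM /w /=; ring.
by rewrite ltr_pdivrMr // mul1r => /ltW.
Qed.

Lemma S_units_dependent (alpha : R[i]) : root (map_poly intr g) alpha ->
  exists k : I -> int, (exists i, k i != 0) /\ \prod_i u_at i alpha ^ k i = 1.
Proof.
move=> g_alpha; have [M kronecker] := kronecker_unity_root g_nonconst A_above.
have [e [[i0 ei0] e_small]] := S_units_small_product M.
have := @horner_prod_expz_on_roots _ R[i] ratr I (map_poly intr g) u e.
rewrite map_poly_ratr_int => /(_ u_neq0)[h hE].
have [|||m m0 hm] := kronecker h _ _ _ g_alpha.
- move=> p r pp gr; rewrite hE //; apply: mem_units_of.
  by have [+ _] := e_small r gr; exact.
- by move=> r gr; rewrite hE //; case: (e_small r gr).
- by rewrite hE //; apply/prodf_neq0 => i _; rewrite expfz_neq0 ?u_neq0.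
exists (fun i => e i * m%:Z); split.
  by exists i0; rewrite mulf_neq0 // eqz_nat -lt0n.
rewrite -[RHS]hm hE // -prodrXl; apply: eq_bigr => i _.
by rewrite -exprz_exp.
Qed.

End SUnits.

Lemma root_shift_units_of (F : numFieldType) (p : nat) (A : subringClosed F)
    (g : {poly int}) (n : nat) (r : F) :
  prime p -> valuation_ring_above p A ->
  ~~ (p %| lead_coef g)%Z -> ~~ (p %| g.[- n%:Z])%Z ->
  root (map_poly intr g) r -> n%:R + r \in units_of A.
Proof.
move=> pp A_above pl pg /rootP gr; pose gn := g \Po ('X - n%:Z%:P).
have gn0 : gn`_0 = g.[- n%:Z] by rewrite -horner_coef0 horner_comp !hornerE.
have lead_gn : lead_coef gn = lead_coef g.
  by rewrite lead_coef_comp ?size_XsubC // lead_coefXsubC expr1n mulr1.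
apply: (root_units_of pp A_above (q := gn)); rewrite ?lead_gn ?gn0 //.
apply/rootP; rewrite map_comp_poly horner_comp rmorphB /= map_polyX map_polyC.
by rewrite !hornerE /= addrAC subrr add0r.
Qed.

Lemma root_shift_neq0 (F : numFieldType) (g : {poly int}) (n : nat) (r : F) :
  g.[- n%:Z] != 0 -> root (map_poly intr g) r -> n%:R + r != 0.
Proof.
move=> gn0 /rootP gr; apply: contraNneq gn0 => /eqP.
rewrite addrC addr_eq0 => /eqP rE.
rewrite -(intr_eq0 F) -horner_map /= rmorphN /= -[n%:~R]/(n%:R) -rE.
by rewrite gr.
Qed.

Lemma translates_dependent (R : realType) (g : {poly int}) (alpha : R[i])
    (S : seq nat) (N : nat) (x : 'I_N -> nat) :
  g != 0 -> root (map_poly intr g) alpha -> injective x ->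
  all prime S ->
  (forall p, prime p -> (p %| lead_coef g)%Z -> p \in S) ->
  (forall n p, prime p -> (p %| g.[- (x n)%:Z])%Z -> p \in S) ->
  (forall n, g.[- (x n)%:Z] != 0) ->
  ((size g).-1 * (size S).+1 < N)%N ->
  multiplicatively_dependent (nat_translate alpha).
Proof.
move=> g0 g_alpha x_inj S_prime S_lead S_value value0 ltN.
have mg0 : map_poly intr g != 0 :> {poly R[i]}.
  by rewrite map_intr_poly_eq0.
have [A A_above] := valuation_rings_above_exist R[i].
have [rs [rs_uniq rs_size rsE]] := closed_field_distinct_roots mg0.
pose u n : {poly rat} := (x n)%:R%:P + 'X.
have uE n (r : R[i]) : (map_poly ratr (u n)).[r] = (x n)%:R + r.
  by rewrite rmorphD /= map_polyX map_polyC !hornerE /= ratr_nat.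
have [|i r gr|i p r pp pS gr||k [[n kn] prod1]] :=
  @S_units_dependent R g A S _ u _ A_above S_prime _ _ rs rsE rs_uniq _ alpha
    g_alpha.
- exact: root_intr_size_gt1 g0 g_alpha.
- by rewrite /= uE; exact: (root_shift_neq0 (value0 i) gr).
- rewrite /= uE; apply: (root_shift_units_of pp (A_above p pp) _ _ gr).
    by apply: contra pS; exact: S_lead pp.
  by apply: contra pS; exact: S_value pp.
- rewrite card_ord; apply: leq_ltn_trans ltN; rewrite leq_mul // -ltnS.
  rewrite prednK ?size_poly_gt0 //; apply: leq_trans rs_size _.
  by rewrite size_map_intr_poly.
exists N, (fun i => (x i)%:R + alpha), k; split.
- by move=> i j /addIr/eqP; rewrite eqr_nat => /eqP/x_inj.
- by move=> i; exists (x i).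
- by exists n; apply/eqP.
- by rewrite -[RHS]prod1; apply: eq_bigr => i _; rewrite /= uE.
Qed.

(** * Smooth values *)

Section SmoothIntegers.
Variable R : realType.
Implicit Types (y : R) (m : int).

Lemma smooth_neq0 y m : 0 <= y -> smooth y m -> m != 0.
Proof.
move=> y0 smooth_m; apply/eqP => m0.
have [p yp pp] := prime_above (Num.truncn y).
have := smooth_m p pp; rewrite m0 dvdz0 -truncn_ge_nat // => /(_ isT).
by rewrite leqNgt yp.
Qed.

Lemma smooth_prime_divisor y m (p : nat) : 0 <= y -> smooth y m ->
  prime p -> (p %| m)%Z -> p \in primes_leq (Num.truncn y).
Proof.
move=> y0 smooth_m pp pm; rewrite mem_primes_leq pp truncn_ge_nat //.
exact: smooth_m.
Qed.

Lemma smooth_translates_dependent (g : {poly int}) (alpha : R[i]) y (N : nat)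
    (x : 'I_N -> nat) :
  g != 0 -> root (map_poly intr g) alpha -> injective x ->
  0 <= y -> (forall n, smooth y g.[- (x n)%:Z]) ->
  ((size g).-1 * (size (primes_leq (Num.truncn y)) +
                  (size (primes `|lead_coef g|)).+1) < N)%N ->
  multiplicatively_dependent (nat_translate alpha).
Proof.
move=> g0 g_alpha x_inj y0 x_smooth ltN.
pose S := primes_leq (Num.truncn y) ++ primes `|lead_coef g|.
apply: (@translates_dependent R g alpha S _ x) => // [|p pp|n p pp p_value|n|].
- rewrite all_cat; apply/andP; split; first exact: filter_all.
  by apply/allP => p; rewrite mem_primes => /andP[].
- rewrite dvdzE /= => p_lead; rewrite mem_cat mem_primes pp absz_gt0.
  by rewrite lead_coef_eq0 g0 p_lead orbT.
- by rewrite mem_cat (smooth_prime_divisor y0 (x_smooth n)).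
- exact: smooth_neq0 (x_smooth n).
- by rewrite size_cat -addnS.
Qed.

End SmoothIntegers.

Section SmoothValues.
Variables (R : realType) (P : {poly int}).

Lemma Psi_arguments (x y : R) : exists t : 'I_(Psi P x y) -> nat,
  injective t /\ forall i, smooth y P.[(t i)%:Z].
Proof.
pose V := fset_set (smooth_values P x y).
have /choice[t tP] (i : 'I_(Psi P x y)) : exists n : nat,
    P.[n%:Z] = nth 0 V i /\ smooth y P.[n%:Z].
  have : nth 0 V i \in V by rewrite mem_nth.
  rewrite in_fset_set; last exact: finite_smooth_values.
  by rewrite inE => -[[n _ <-] ?]; exists n.
exists t; split=> [i j tij|i]; last by case: (tP i).
apply/val_inj/eqP; rewrite -(nth_uniq 0 (ltn_ord i) (ltn_ord j) (fset_uniq V)).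
by rewrite -(tP i).1 -(tP j).1 tij.
Qed.

Lemma Psi_exceeds_primes (c d : nat) :
  (forall B : R, exists x y : R,
     [/\ 2 <= x, 2 <= y & B < (Psi P x y)%:R * ln y / y]) ->
  exists x y : R, 2 <= y /\
    (c * size (primes_leq (Num.truncn y)) + d < Psi P x y)%N.
Proof.
move=> unbounded.
have [x [y [_ y2 large]]] := unbounded (c%:R * (2 + 2 * ln 8) + d%:R).
exists x, y; split=> //; rewrite ltnNge; apply/negP => Psi_le.
have y0 : 0 < y by lra.
have lny0 : 0 <= ln y by apply: ln_ge0; lra.
have lny_le : ln y <= y := ltW (ln_sublinear y0).
move: large; rewrite ltNge => /negP; apply; rewrite ler_pdivrMr //.
apply: (@le_trans _ _
    ((c * size (primes_leq (Num.truncn y)) + d)%:R * ln y)).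
  by rewrite ler_wpM2r // ler_nat.
rewrite natrD natrM mulrDl [leRHS]mulrDl -!mulrA.
apply: lerD; apply: ler_wpM2l => //.
exact: chebyshev_upper.
Qed.

End SmoothValues.

Theorem theorem3 (R : realType)
  (unbounded_Psi : forall P : {poly int}, (1 < size P)%N ->
    forall B : R, exists x y : R,
      [/\ 2 <= x, 2 <= y & B < (Psi P x y)%:R * ln y / y]) :
  (forall alpha : R[i], algebraic_number alpha ->
     multiplicatively_dependent (nat_translate alpha)) /\
  ~ (exists alpha : R[i], algebraic_number alpha /\
       multiplicatively_independent (nat_translate alpha)).
Proof.
suff dependent (alpha : R[i]) : algebraic_number alpha ->
    multiplicatively_dependent (nat_translate alpha).
  by split=> // -[alpha [/dependent]].
move=> /algebraicOver_int[g g0 g_alpha].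
pose P := g \Po (- 'X); pose L := primes `|lead_coef g|.
have size_P : (1 < size P)%N.
  rewrite size_comp_poly2 ?size_polyN ?size_polyX //.
  exact: root_intr_size_gt1 g0 g_alpha.
have [x [y [y2 Psi_large]]] := Psi_exceeds_primes (size g).-1
  ((size g).-1 * (size L).+1) (unbounded_Psi P size_P).
have [t [t_inj t_smooth]] := Psi_arguments P x y.
apply: (smooth_translates_dependent g0 g_alpha t_inj (y := y)).
- by lra.
- by move=> n; have := t_smooth n; rewrite horner_comp hornerN hornerX.
- by rewrite mulnDr.
Qed.
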